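(* Let $\mathfrak R$ be a complete, separated right linear topological ring. Let $(\mathfrak f_{y,x}\colon\mathfrak P_x\to\mathfrak P_y)_{x<y\in X}$ be a (commutative) diagram of projective left $\mathfrak R$-contramodules, indexed by a directed poset $X$, and let $\mathfrak F=\varinjlim_{x\in X}\mathfrak P_x$ be its direct limit in the category $\mathfrak R\text{-contra}$. Assume that the $\mathfrak R$-contramodule $\mathfrak F$ has a projective cover in $\mathfrak R\text{-contra}$. Then $\mathfrak F$ is a projective left $\mathfrak R$-contramodule.
   Context: Rings are associative and unital. A topological ring $\mathfrak R$ is right linear if its open right ideals form a base of neighborhoods of zero; it is separated and complete if the natural map $\mathfrak R\to\varprojlim_{\mathfrak I}\mathfrak R/\mathfrak I$ ($\mathfrak I$ ranging over the open right ideals) is injective and surjective, respectively. Contramodules. For an abelian group $A$ and a set $X$, $A[X]=A^{(X)}$ is the direct sum of $X$ copies of $A$. For a set $X$, $\mathfrak R[[X]]=\varprojlim_{\mathfrak I}(\mathfrak R/\mathfrak I)[X]\subset\mathfrak R^X$ is the set of all formal linear combinations $\sum_{x\in X}r_xx$ whose family of coefficients converges to zero, i.e., for every open right ideal $\mathfrak I$ the set $\{x: r_x\notin\mathfrak I\}$ is finite. A map $f\colon X\to Y$ induces $\sum_x r_xx\mapsto\sum_y\bigl(\sum_{f(x)=y}r_x\bigr)y$ (infinite sums are limits of finite partial sums in $\mathfrak R$). With the unit $\epsilon_X\colon X\to\mathfrak R[[X]]$, $x\mapsto 1\cdot x$, and the ''opening of parentheses'' map $\phi_X\colon\mathfrak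 R[[\mathfrak R[[X]]]]\to\mathfrak R[[X]]$ (multiply coefficients and take the convergent sums), $\mathfrak R[[-]]$ is a monad on the category of sets. A left $\mathfrak R$-contramodule is an algebra over this monad, i.e., a set $\mathfrak C$ with a contraaction map $\pi_{\mathfrak C}\colon\mathfrak R[[\mathfrak C]]\to\mathfrak C$ satisfying associativity and unitality. Left $\mathfrak R$-contramodules form a cocomplete abelian category $\mathfrak R\text{-contra}$ with enough projectives; the projectives are the direct summands of the free contramodules $\mathfrak R[[X]]$. Direct limits are colimits indexed by directed posets. Covers. For a class of objects $\mathsf L$ in a category, a morphism $l\colon L\to A$ is an $\mathsf L$-precover if $L\in\mathsf L$ and every morphism $L'\to A$ with $L'\in\mathsf L$ factors through $l$; an $\mathsf L$-precover $l$ is an $\mathsf L$-cover if every endomorphism $f\colon L\to L$ with $lf=l$ is an automorphism. A projective cover is an $\mathsf L$-cover for $\mathsf L$ the class of projective objects. *)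

(* Defs.v *)
From HB Require Import structures.
From mathcomp Require Import all_boot all_order all_algebra finmap.
From mathcomp Require Import boolp classical_sets functions cardinality.
From mathcomp Require Import topology tvs.
From mathcomp Require summability.

Set Implicit Arguments.
Unset Strict Implicit.
Unset Printing Implicit Defensive.

Import Order.TTheory GRing.Theory.

Local Open Scope classical_set_scope.
Local Open Scope ring_scope.

(* Rings are associative and unital, possibly zero: hence [pzRingType]. *)
HB.mixin Record TopologicalZmodule_isTopologicalRing R
    & TopologicalZmodule R & GRing.PzRing R := {
  ring_mul_continuous : continuous (fun x : R * R => x.1 * x.2)
}.

#[short(type="topologicalRingType")]
HB.structure Definition TopologicalRing :=
  {R of TopologicalZmodule R & GRing.PzRing R
      & TopologicalZmodule_isTopologicalRing R}.

Section RightIdeals.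
Variable R : topologicalRingType.
Implicit Types (I J : set R) (x y r : R).

Definition right_ideal I : Prop :=
  [/\ I 0, forall x y, I x -> I y -> I (x + y) & forall x r, I x -> I (x * r)].

Definition open_right_ideal I : Prop := open I /\ right_ideal I.

Definition right_linear : Prop :=
  forall U : set R, nbhs (0 : R) U ->
    exists2 I, open_right_ideal I & I `<=` U.

Definition coset I x : set R := [set y | I (y - x)].

(* An element of the projective limit of the R/I, given as a choice of a coset
   of every open right ideal I; for I `<=` J the transition map R/I -> R/J
   sends a coset of I to the coset of J containing it.  The values of [c] off
   the open right ideals are irrelevant. *)
Definition compatible_cosets (c : set R -> set R) : Prop :=
  (forall I, open_right_ideal I -> exists x, c I = coset I x) /\
  (forall I J, open_right_ideal I -> open_right_ideal J -> I `<=` J ->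
     c I `<=` c J).

Definition separated : Prop :=
  forall x y, (forall I, open_right_ideal I -> coset I x = coset I y) -> x = y.

Definition complete : Prop :=
  forall c, compatible_cosets c ->
    exists x, forall I, open_right_ideal I -> c I = coset I x.

End RightIdeals.

Arguments right_linear : clear implicits.
Arguments separated : clear implicits.
Arguments complete : clear implicits.

HB.mixin Record isCompleteSeparatedRightLinear R & TopologicalRing R := {
  ring_right_linear : right_linear R ;
  ring_separated : separated R ;
  ring_complete : complete R
}.

#[short(type="completeRightLinearRingType")]
HB.structure Definition CompleteRightLinearRing :=
  {R of TopologicalRing R & isCompleteSeparatedRightLinear R}.

Definition cvg_zero (R : topologicalRingType) (X : Type) (r : X -> R) : Prop :=
  forall I : set R, open_right_ideal I -> finite_set [set x | ~ I (r x)].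

(* The limit of the finite partial sums; junk value 0 if there is none. *)
Definition inf_sum (R : topologicalRingType) (X : Type) (r : X -> R) : R :=
  xget 0 [set s : R |
    @summability.partial_sum {classic X} R r @ summability.totally --> s].

(* The set R[[X]]. *)
Record formal_comb (R : topologicalRingType) (X : Type) := FormalComb {
  coef :> X -> R ;
  coefP : cvg_zero coef
}.

Section RightIdealTheory.
Variable R : topologicalRingType.
Variable I : set R.
Hypothesis oI : open_right_ideal I.

Let I0 : I 0. Proof. by case: oI => _ []. Qed.
Let ID x y : I x -> I y -> I (x + y).
Proof. by case: oI => _ [] _ + _; apply. Qed.
Let IM x r : I x -> I (x * r).
Proof. by case: oI => _ [] _ _; apply. Qed.
Let IN x : I x -> I (- x).
Proof. by rewrite -mulrN1; exact: IM. Qed.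

Lemma right_idealBC x y : I (x - y) -> I (y - x).
Proof. by move/IN; rewrite opprB. Qed.

Lemma right_ideal_trans y x z : I (x - y) -> I (y - z) -> I (x - z).
Proof. by move=> xy yz; have := ID xy yz; rewrite addrA subrK. Qed.

Lemma right_ideal_sum (T : eqType) (s : seq T) (F : T -> R) :
  (forall x, x \in s -> I (F x)) -> I (\sum_(x <- s) F x).
Proof. by move=> h; rewrite big_seq; elim/big_ind: _ => //; exact: ID. Qed.

Lemma eq_coset x y : I (x - y) -> coset I x = coset I y.
Proof.
move=> xy; apply/seteqP; split => z /= h; first exact: right_ideal_trans h xy.
exact: right_ideal_trans h (right_idealBC xy).
Qed.

Lemma coset_eq x y : coset I x = coset I y -> I (x - y).
Proof.
move=> e; have : coset I x x by rewrite /coset /= subrr.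
by rewrite e.
Qed.

Lemma nbhs_coset x : nbhs x (coset I x).
Proof.
have : {for x, continuous (fun y => y - x)}.
  apply: (@continuous_comp _ _ _ (fun y => (y, - x)) (fun z : R * R => z.1 + z.2)).
    by apply: cvg_pair => /=; [exact: cvg_id | exact: cvg_cst].
  exact: add_continuous.
by apply; rewrite subrr; apply: open_nbhs_nbhs; split => //; case: oI.
Qed.

End RightIdealTheory.

Section InfiniteSums.
Variable R : completeRightLinearRingType.

Lemma nbhs_cosetP (x : R) (U : set R) :
  nbhs x U -> exists2 I, open_right_ideal I & coset I x `<=` U.
Proof.
move=> xU; have : {for 0, continuous (fun y : R => y + x)}.
  apply: (@continuous_comp _ _ _ (fun y => (y, x)) (fun z : R * R => z.1 + z.2)).
    by apply: cvg_pair => /=; [exact: cvg_id | exact: cvg_cst].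
  exact: add_continuous.
move=> /(_ U); rewrite add0r => /(_ xU) /ring_right_linear[I oI IU].
by exists I => // y /IU /=; rewrite subrK.
Qed.

Variable X : Type.
Local Notation T := {classic X}.
Implicit Types (r : X -> R) (A B : {fset T}).

Lemma partial_sumE r A :
  @summability.partial_sum T R r A = \sum_(x <- A) r x.
Proof. by rewrite /summability.partial_sum big_seq_fsetE. Qed.

Lemma partial_sum_close r (I : set R) A B :
  open_right_ideal I -> (A `<=` B)%fset ->
  (forall x : T, x \notin A -> I (r x)) ->
  I (\sum_(x <- B) r x - \sum_(x <- A) r x).
Proof.
move=> oI AB h; rewrite (big_fsetID _ (mem A)) /=.
have -> : [fset x in B | x \in A]%fset = A.
  by apply/fsetP => x; rewrite !inE /= andbC; case: (boolP (x \in A)) => // /(fsubsetP AB).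
rewrite addrAC subrr add0r; apply: right_ideal_sum => // x.
by rewrite !inE => /andP[_ /h].
Qed.

Lemma cvg_zero_fset r (I : set R) : cvg_zero r -> open_right_ideal I ->
  {A : {fset T} | forall x : T, x \notin A -> I (r x)}.
Proof.
move=> r0 oI; have fin : finite_set ([set x | ~ I (r x)] : set T) by exact: r0.
exists (fset_set ([set x | ~ I (r x)] : set T)) => x.
by rewrite in_fset_set// notin_setE /= => /contrapT.
Qed.

Lemma cvg_inf_sum r : cvg_zero r ->
  @summability.partial_sum T R r @ summability.totally --> inf_sum r.
Proof.
move=> r0; suff [s hs] : exists s : R,
    @summability.partial_sum T R r @ summability.totally --> s.
  by rewrite /inf_sum; case: xgetP => [x -> //|/(_ s)].
pose A I : {fset T} :=
  if pselect (open_right_ideal I) is left oI then sval (cvg_zero_fset r0 oI)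
  else fset0.
have AP I : open_right_ideal I -> forall x : T, x \notin A I -> I (r x).
  by move=> oI; rewrite /A; case: pselect => // oI'; case: cvg_zero_fset.
pose c I := coset I (\sum_(x <- A I) r x).
have close I B : open_right_ideal I -> (A I `<=` B)%fset ->
    I (\sum_(x <- B) r x - \sum_(x <- A I) r x).
  by move=> oI AB; apply: partial_sum_close => //; exact: AP.
have [|s hs] := @ring_complete R c.
  split=> [I oI|I J oI oJ IJ y /=]; first by eexists.
  rewrite /c /coset /= => /IJ hy; pose B := (A I `|` A J)%fset.
  apply: (right_ideal_trans oJ hy).
  apply: (right_ideal_trans oJ (y := \sum_(x <- B) r x)).
    by apply: (right_idealBC oJ); apply: IJ; apply: close => //; exact: fsubsetUl.
  by apply: close => //; exact: fsubsetUr.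
exists s => U /nbhs_cosetP[I oI IU]; exists (A I) => // B /= AB; apply: IU.
rewrite /= partial_sumE /coset /=; apply: (right_ideal_trans oI (close _ _ oI AB)).
by apply: (coset_eq oI); exact: hs.
Qed.

Lemma inf_sum_close r (I : set R) A : cvg_zero r -> open_right_ideal I ->
  (forall x : T, x \notin A -> I (r x)) -> I (inf_sum r - \sum_(x <- A) r x).
Proof.
move=> r0 oI h; have [B _ hB] := cvg_inf_sum r0 (nbhs_coset oI (inf_sum r)).
have {hB} := hB (A `|` B)%fset (fsubsetUr _ _).
rewrite /= partial_sumE /coset /= => /(right_idealBC oI) hB.
by apply: (right_ideal_trans oI hB); apply: partial_sum_close => //; exact: fsubsetUl.
Qed.

Lemma inf_sum_ideal r (I : set R) : open_right_ideal I ->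
  (forall x, I (r x)) -> I (inf_sum r).
Proof.
move=> oI h; rewrite /inf_sum; case: xgetP => [s _ /(_ _ (nbhs_coset oI s))|_].
  move=> [A _ /(_ A)] /=; rewrite fsubset_refl partial_sumE => /(_ isT).
  move=> /(right_idealBC oI) hA; rewrite -[s]subr0.
  by apply: (right_ideal_trans oI hA); rewrite subr0; exact: right_ideal_sum.
by case: oI => _ [].
Qed.

End InfiniteSums.

Section Monad.
Variable R : completeRightLinearRingType.

Section Map.
Variables (X Y : Type) (f : X -> Y).

Definition fc_map_coef (r : X -> R) (y : Y) : R :=
  inf_sum (fun x => if `[< f x = y >] then r x else 0).

Lemma fc_map_subproof (r : formal_comb R X) : cvg_zero (fc_map_coef r).
Proof.
move=> I oI; apply: (@sub_finite_set _ _ (f @` [set x | ~ I (r x)])).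
  move=> y /=; apply: contra_notP => h; apply: inf_sum_ideal => // x.
  case: asboolP => [fxy|_]; last by case: oI => _ [].
  by apply: contrapT => Irx; apply: h; exists x.
by apply: finite_image; exact: coefP.
Qed.

Definition fc_map (r : formal_comb R X) : formal_comb R Y :=
  FormalComb (fc_map_subproof r).

End Map.

Section Unit.
Variable X : Type.

Lemma fc_unit_subproof (x : X) :
  cvg_zero (fun y => if `[< y = x >] then 1 else 0 : R).
Proof.
move=> I oI; apply: (@sub_finite_set _ _ [set x]) => // y /=.
by case: asboolP => // _ h; exfalso; apply: h; case: oI => _ [].
Qed.

Definition fc_unit (x : X) : formal_comb R X := FormalComb (fc_unit_subproof x).

End Unit.

Section Mult.
Variable X : Type.

Definition fc_mult_coef (w : formal_comb R (formal_comb R X)) (x : X) : R :=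
  inf_sum (fun u : formal_comb R X => w u * u x).

Lemma mul_open_right_ideal (a : R) (I : set R) : open_right_ideal I ->
  exists2 J, open_right_ideal J & forall b, J b -> I (a * b).
Proof.
move=> oI; have : {for 0, continuous (fun b : R => a * b)}.
  apply: (@continuous_comp _ _ _ (fun y => (a, y)) (fun z : R * R => z.1 * z.2)).
    by apply: cvg_pair => /=; [exact: cvg_cst | exact: cvg_id].
  exact: ring_mul_continuous.
move=> /(_ I); rewrite mulr0 => /(_ _)/ring_right_linear[|J oJ JI].
  by apply: open_nbhs_nbhs; case: oI => ? [].
by exists J => // b /JI.
Qed.

Lemma fc_mult_subproof (w : formal_comb R (formal_comb R X)) :
  cvg_zero (fc_mult_coef w).
Proof.
move=> I oI; have [I0 _ IM] : right_ideal I by case: oI.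
apply: (@sub_finite_set _ _
  (\bigcup_(u in [set u | ~ I (w u)]) [set x | ~ I (w u * (u : X -> R) x)])).
  move=> x /=; apply: contra_notP => h; apply: inf_sum_ideal => // u.
  have [Iwu|nIwu] := pselect (I (w u)); first exact: IM.
  by apply: contrapT => nI; apply: h; exists u.
apply: bigcup_finite => [|u _]; first exact: coefP.
have [J oJ JI] := mul_open_right_ideal (w u) oI.
apply: sub_finite_set (coefP u oJ) => x /=.
by apply: contra_not; exact: JI.
Qed.

Definition fc_mult (w : formal_comb R (formal_comb R X)) : formal_comb R X :=
  FormalComb (fc_mult_subproof w).

End Mult.
End Monad.

Record contramodule (R : completeRightLinearRingType) := Contramodule {
  carrier :> Type ;
  contraaction : formal_comb R carrier -> carrier ;
  contra_assoc : forall w : formal_comb R (formal_comb R carrier),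
    contraaction (fc_mult w) = contraaction (fc_map contraaction w) ;
  contra_unit : forall c : carrier, contraaction (fc_unit R c) = c
}.

Record contrahom (R : completeRightLinearRingType) (C D : contramodule R) :=
  Contrahom {
    contrahom_fun :> C -> D ;
    contrahomP : forall r : formal_comb R C,
      contrahom_fun (contraaction r) = contraaction (fc_map contrahom_fun r)
  }.

(* Morphisms are compared as functions, by pointwise equality. *)
Section Category.
Variable R : completeRightLinearRingType.
Implicit Types A B C D L P Z : contramodule R.

Definition contra_epi B C (e : contrahom B C) : Prop :=
  forall Z (g h : contrahom C Z), g \o e =1 h \o e -> g =1 h.

Definition contra_projective P : Prop :=
  forall B C (e : contrahom B C) (g : contrahom P C), contra_epi e ->
    exists h : contrahom P B, e \o h =1 g.

Definition contra_iso B C (f : contrahom B C) : Prop :=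
  exists2 g : contrahom C B, g \o f =1 id & f \o g =1 id.

Definition precover (cL : contramodule R -> Prop) L A (l : contrahom L A) :
    Prop :=
  cL L /\ forall L' (l' : contrahom L' A), cL L' ->
    exists h : contrahom L' L, l \o h =1 l'.

Definition cover (cL : contramodule R -> Prop) L A (l : contrahom L A) : Prop :=
  precover cL l /\
  forall f : contrahom L L, l \o f =1 l -> contra_iso f.

Definition projective_cover P A (p : contrahom P A) : Prop :=
  cover contra_projective p.

Definition has_projective_cover A : Prop :=
  exists P (p : contrahom P A), projective_cover p.

End Category.

Definition directed d (X : porderType d) : Prop :=
  (exists x : X, True) /\
  forall x y : X, exists z : X, (x <= z)%O /\ (y <= z)%O.

Section Diagram.
Variables (R : completeRightLinearRingType) (d : Order.disp_t).
Variables (X : porderType d) (P : X -> contramodule R).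
Variable f : forall y x : X, (x < y)%O -> contrahom (P x) (P y).

Definition commutative_diagram : Prop :=
  forall (x y z : X) (xy : (x < y)%O) (yz : (y < z)%O) (xz : (x < z)%O),
    f yz \o f xy =1 f xz.

Definition is_cocone Z (g : forall x, contrahom (P x) Z) : Prop :=
  forall (x y : X) (xy : (x < y)%O), g y \o f xy =1 g x.

Definition is_colimit F (i : forall x, contrahom (P x) F) : Prop :=
  is_cocone i /\
  forall Z (g : forall x, contrahom (P x) Z), is_cocone g ->
    (exists h : contrahom F Z, forall x, h \o i x =1 g x) /\
    (forall h h' : contrahom F Z,
       (forall x, h \o i x =1 g x) -> (forall x, h' \o i x =1 g x) -> h =1 h').

End Diagram.

(* Main.v *)
(** Let [T] be the disjoint union of the [P x] and [q : R[[T]] -> F] the map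
sending a generator [(x, a)] to [i x a].  For every [z], choose a section [s_z]
of [R[[P z]]] onto [P z]; the endomorphism [push z] of [R[[T]]] sends [(x, a)] to
[s_z (f_zx a)] if [x <= z] and fixes it otherwise, so that
[q \o push z = q].  Direct limits of contramodules are not exact, but if
[q w = q w'] then, modulo any given open right ideal, [push z w] and [push z w']
agree for all large [z]: this eventual congruence is compatible with infinite
combinations because only finitely many coefficients matter, hence the quotient
of [R[[T]]] by it is a contramodule, and the universal property of [F] applies.

If [p : Q -> F] is a projective cover, lift [p] to [u : Q -> R[[T]]] along [q] and
[q] to [v : R[[T]] -> Q] along [p].  As [v \o push z \o u] commutes with [p], it
is an automorphism of [Q].  If [p y = p y'], its values at [y] and [y'] agree
modulo [I] for large [z], hence so do [y] and [y'].  Since [Q] is a summand of a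
free contramodule it is separated, so [p] is injective; lifting the [i x] along
[p] then yields a section of [p]. *)

Require Import Defs.
From mathcomp Require Import all_boot all_order.
From mathcomp Require Import all_algebra finmap.
From mathcomp Require Import boolp classical_sets cardinality.

Set Implicit Arguments.
Unset Strict Implicit.
Unset Printing Implicit Defensive.

Import Order.TTheory GRing.Theory.

Local Open Scope classical_set_scope.
Local Open Scope ring_scope.

(** * Convergent sums: congruences modulo open right ideals, exchange of summation *)

Section InfiniteSums.
Variable R : completeRightLinearRingType.

Lemma eq_from_ideals (x y : R) :
  (forall I, open_right_ideal I -> I (x - y)) -> x = y.
Proof.
by move=> h; apply: ring_separated => I oI; apply: eq_coset => //; exact: h.
Qed.

(** Modulo [I], both sums reduce to sums over one common finite set, where the terms are
    congruent. *)
Lemma inf_sum_sub_ideal X (r s : X -> R) (I : set R) :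
  cvg_zero r -> cvg_zero s -> open_right_ideal I ->
  (forall x, I (r x - s x)) -> I (inf_sum r - inf_sum s).
Proof.
move=> r0 s0 oI h.
have [A hA] := cvg_zero_fset r0 oI; have [B hB] := cvg_zero_fset s0 oI.
pose C := (A `|` B)%fset.
have rC : I (inf_sum r - \sum_(x <- C) r x).
  by apply: inf_sum_close => // x; rewrite inE negb_or => /andP[/hA].
have sC : I (inf_sum s - \sum_(x <- C) s x).
  by apply: inf_sum_close => // x; rewrite inE negb_or => /andP[_ /hB].
apply: (right_ideal_trans oI rC).
apply: (right_ideal_trans oI _ (right_idealBC oI sC)).
by rewrite -sumrB; apply: right_ideal_sum.
Qed.

Lemma inf_sum_fin X (r : X -> R) (A : {fset {classic X}}) :
  (forall x : {classic X}, x \notin A -> r x = 0) ->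
  inf_sum r = \sum_(x <- A) r x.
Proof.
move=> h; apply: eq_from_ideals => I oI; apply: inf_sum_close => //.
  move=> J [_ [J0 _ _]]; apply: (@sub_finite_set {classic X} _ [set` A]) => // x /=.
  by apply: contra_notP => /negP /h ->.
by move=> x /h ->; case: oI => _ [].
Qed.

Lemma inf_sum1 X (r : X -> R) x :
  (forall y, y <> x -> r y = 0) -> inf_sum r = r x.
Proof.
move=> h; rewrite (@inf_sum_fin _ _ [fset (x : {classic X})]%fset) ?big_seq_fset1//.
by move=> y; rewrite inE => /eqP; exact: h.
Qed.

Lemma cvg_zero_mulr X (r c : X -> R) :
  cvg_zero r -> cvg_zero (fun x => r x * c x).
Proof.
move=> r0 I oI; apply: sub_finite_set (r0 I oI) => x /=; apply: contra_not.
by case: oI => _ [_ _ +]; apply.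
Qed.

Lemma mulr_inf_suml X (r : X -> R) (c : R) :
  cvg_zero r -> inf_sum r * c = inf_sum (fun x => r x * c).
Proof.
move=> r0; have IM I x : open_right_ideal I -> I x -> I (x * c).
  by move=> [_ [_ _ +]]; apply.
have rc0 : cvg_zero (fun x => r x * c) by exact: cvg_zero_mulr.
apply: eq_from_ideals => I oI; have [A hA] := cvg_zero_fset r0 oI.
apply: (right_ideal_trans oI (y := \sum_(x <- A) r x * c)).
  by rewrite -mulr_suml -mulrBl; apply: IM => //; exact: inf_sum_close.
by apply: (right_idealBC oI); apply: inf_sum_close => // x /hA /(IM _ _ oI).
Qed.

(** A right ideal need not be stable under left multiplication, so the tail is controlled modulo
    some [J] with [c * J] inside [I], given by continuity. *)
Lemma mulr_inf_sumr X (r : X -> R) (c : R) :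
  cvg_zero r -> c * inf_sum r = inf_sum (fun x => c * r x).
Proof.
move=> r0.
have cr0 : cvg_zero (fun x => c * r x).
  move=> I oI; have [J oJ JI] := mul_open_right_ideal c oI.
  by apply: sub_finite_set (r0 J oJ) => x /=; apply: contra_not; exact: JI.
apply: eq_from_ideals => I oI; have [J oJ JI] := mul_open_right_ideal c oI.
have [A hA] := cvg_zero_fset r0 oJ.
apply: (right_ideal_trans oI (y := \sum_(x <- A) c * r x)).
  by rewrite -mulr_sumr -mulrBr; apply: JI; exact: inf_sum_close.
by apply: (right_idealBC oI); apply: inf_sum_close => // x /hA /JI.
Qed.

Lemma cvg_zero_row X Y (a : X -> Y -> R) x :
  cvg_zero (fun z : X * Y => a z.1 z.2) -> cvg_zero (a x).
Proof.
move=> a0 I oI; apply: sub_finite_set (finite_image snd (a0 I oI)) => y /= nI.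
by exists (x, y).
Qed.

Lemma cvg_zero_swap X Y (a : X -> Y -> R) :
  cvg_zero (fun z : X * Y => a z.1 z.2) ->
  cvg_zero (fun z : Y * X => a z.2 z.1).
Proof.
move=> a0 I oI.
apply: sub_finite_set (finite_image (fun z => (z.2, z.1)) (a0 I oI)).
by move=> [y x] /= nI; exists (x, y).
Qed.

Lemma cvg_zero_inf_sum X Y (a : X -> Y -> R) :
  cvg_zero (fun z : X * Y => a z.1 z.2) -> cvg_zero (fun x => inf_sum (a x)).
Proof.
move=> a0 I oI; apply: sub_finite_set (finite_image fst (a0 I oI)) => x /=.
apply: contra_notP => h; apply: inf_sum_ideal => // y.
by apply: contrapT => nI; apply: h; exists (x, y).
Qed.

(** Terms outside the rectangle lie in [I], so the omitted rows and the omitted parts of rows sum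
    into [I]. *)
Lemma inf_sum_rect X Y (a : X -> Y -> R) (I : set R)
    (A : {fset {classic X}}) (B : {fset {classic Y}}) :
  cvg_zero (fun z : X * Y => a z.1 z.2) -> open_right_ideal I ->
  (forall x y, ~ I (a x y) -> (x : {classic X}) \in A /\ (y : {classic Y}) \in B) ->
  I (inf_sum (fun x => inf_sum (a x)) - \sum_(x <- A) \sum_(y <- B) a x y).
Proof.
move=> a0 oI h.
apply: (right_ideal_trans oI (y := \sum_(x <- A) inf_sum (a x))).
  apply: inf_sum_close => //; first exact: cvg_zero_inf_sum.
  move=> x xA; apply: inf_sum_ideal => // y; apply: contrapT => /h[].
  by rewrite (negbTE xA).
rewrite -sumrB; apply: right_ideal_sum => // x _; apply: inf_sum_close => //.
  exact: cvg_zero_row a0.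
by move=> y yB; apply: contrapT => /h[_]; rewrite (negbTE yB).
Qed.

(** Modulo each [I], both iterated sums reduce to one finite sum, over the rectangle spanned by the
    finitely many terms outside [I]. *)
Lemma exchange_inf_sum X Y (a : X -> Y -> R) :
  cvg_zero (fun z : X * Y => a z.1 z.2) ->
  inf_sum (fun x => inf_sum (a x)) = inf_sum (fun y => inf_sum (a^~ y)).
Proof.
move=> a0; apply: eq_from_ideals => I oI.
have finA : finite_set (fst @` [set z | ~ I (a z.1 z.2)] : set {classic X}).
  exact: finite_image (a0 I oI).
have finB : finite_set (snd @` [set z | ~ I (a z.1 z.2)] : set {classic Y}).
  exact: finite_image (a0 I oI).
pose A := fset_set (fst @` [set z | ~ I (a z.1 z.2)] : set {classic X}).
pose B := fset_set (snd @` [set z | ~ I (a z.1 z.2)] : set {classic Y}).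
have hAB x y : ~ I (a x y) -> (x : {classic X}) \in A /\ (y : {classic Y}) \in B.
  by move=> nI; rewrite !in_fset_set// !inE; split; exists (x, y).
apply: (right_ideal_trans oI (inf_sum_rect a0 oI hAB)).
apply: (right_idealBC oI); rewrite exchange_big /=.
apply: (@inf_sum_rect _ _ (fun y x => a x y)) => //.
  exact: cvg_zero_swap.
by move=> y x /hAB[].
Qed.

End InfiniteSums.

(** * The monad in Kleisli form, and congruence of formal combinations *)

Section Monad.
Variable R : completeRightLinearRingType.

Lemma formal_combP X (u v : formal_comb R X) : (forall x, u x = v x) -> u = v.
Proof.
case: u v => [u u0] [v v0] /= /funext uv; case: _ / uv v0 => v0.
by congr FormalComb; exact: Prop_irrelevance.
Qed.

(** Rows with [w x] in [I] lie in [I] entirely; each of the finitely many others converges by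
    continuity of left multiplication. *)
Lemma cvg_zero_mul X Y (w : X -> R) (u : X -> formal_comb R Y) :
  cvg_zero w -> cvg_zero (fun z : X * Y => w z.1 * u z.1 z.2).
Proof.
move=> w0 I oI; have [I0 _ IM] : right_ideal I by case: oI.
apply: (@sub_finite_set _ _ (\bigcup_(x in [set x | ~ I (w x)])
  (pair x @` [set y | ~ I (w x * u x y)]))) => [[x y] /= nI|].
  by exists x => /=; [apply: contra_not nI => /IM | exists y].
apply: bigcup_finite => [|x _]; first exact: w0.
apply: finite_image; have [J oJ JI] := mul_open_right_ideal (w x) oI.
by apply: sub_finite_set (coefP (u x) oJ) => y /=; apply: contra_not; exact: JI.
Qed.

(** Kleisli extension: the row vector [w] times the matrix with rows [u x]. *)
Definition fc_bind X Y (w : formal_comb R X) (u : X -> formal_comb R Y) :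
  formal_comb R Y := fc_mult (fc_map u w).

(** [fc_map] groups the [x] by the value of [u x]; exchanging sums over an array supported on the
    graph of [u] undoes the grouping. *)
Lemma fc_bindE X Y (w : formal_comb R X) (u : X -> formal_comb R Y) y :
  fc_bind w u y = inf_sum (fun x => w x * u x y).
Proof.
pose a (v : formal_comb R Y) (x : X) : R :=
  (if `[< u x = v >] then w x else 0) * v y.
have a0 : cvg_zero (fun z => a z.1 z.2).
  move=> I oI; have [I0 _ IM] : right_ideal I by case: oI.
  apply: sub_finite_set (finite_image (fun x => (u x, x)) (coefP w oI)).
  move=> [v x] /=; rewrite /a /=; case: asboolP => [<-|_]; last by rewrite mul0r.
  by move=> nI; exists x => //; apply: contra_not nI => /IM.
transitivity (inf_sum (fun v => inf_sum (a v))).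
  congr inf_sum; apply/funext => v; rewrite mulr_inf_suml//.
  move=> I oI; have [I0 _ _] : right_ideal I by case: oI.
  by apply: sub_finite_set (coefP w oI) => x /=; case: asboolP.
rewrite exchange_inf_sum//; congr inf_sum; apply/funext => x.
rewrite (@inf_sum1 _ _ _ (u x)) /a; first by case: asboolP.
by move=> v vx; case: asboolP => [/esym//|_]; rewrite mul0r.
Qed.

Lemma fc_bind_unit X Y x (u : X -> formal_comb R Y) :
  fc_bind (fc_unit R x) u = u x.
Proof.
apply: formal_combP => y; rewrite fc_bindE (@inf_sum1 _ _ _ x) /=.
  by case: asboolP => // _; rewrite mul1r.
by move=> x' nx; case: asboolP => // _; rewrite mul0r.
Qed.

Lemma fc_mapE X Y (f : X -> Y) w : fc_map f w = fc_bind w (@fc_unit R Y \o f).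
Proof.
apply: formal_combP => y; rewrite fc_bindE; congr inf_sum; apply/funext => x /=.
case: asboolP => [->|ne]; case: asboolP => //; rewrite ?mulr1 ?mulr0//.
by move=> e; case: ne.
Qed.

Lemma fc_multE X (w : formal_comb R (formal_comb R X)) : fc_mult w = fc_bind w id.
Proof. by apply: formal_combP => x; rewrite fc_bindE. Qed.

Lemma fc_bind_unitr X (w : formal_comb R X) : fc_bind w (@fc_unit R X) = w.
Proof.
apply: formal_combP => y; rewrite fc_bindE (@inf_sum1 _ _ _ y) /=.
  by case: asboolP => // _; rewrite mulr1.
by move=> x /nesym ne; case: asboolP => // _; rewrite mulr0.
Qed.

Lemma fc_bindA X Y Z (w : formal_comb R X) (u : X -> formal_comb R Y)
    (v : Y -> formal_comb R Z) :
  fc_bind (fc_bind w u) v = fc_bind w (fun x => fc_bind (u x) v).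
Proof.
apply: formal_combP => z; rewrite !fc_bindE.
have wu0 := cvg_zero_mul u (coefP w).
transitivity (inf_sum (fun y => inf_sum (fun x => w x * u x y * v y z))).
  congr inf_sum; apply/funext => y; rewrite fc_bindE mulr_inf_suml//.
  by apply: cvg_zero_mulr; exact: coefP.
rewrite (@exchange_inf_sum _ _ _ (fun y x => w x * u x y * v y z)); last first.
  apply: (@cvg_zero_swap _ _ _ (fun x y => w x * u x y * v y z)).
  exact: cvg_zero_mulr.
congr inf_sum; apply/funext => x; rewrite fc_bindE mulr_inf_sumr.
  by congr inf_sum; apply/funext => y; rewrite mulrA.
by apply: cvg_zero_mulr; exact: coefP.
Qed.

Lemma fc_bind_map X Y Z (f : X -> Y) w (u : Y -> formal_comb R Z) :
  fc_bind (fc_map f w) u = fc_bind w (u \o f).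
Proof.
rewrite fc_mapE fc_bindA; congr fc_bind.
by apply/funext => x; exact: fc_bind_unit.
Qed.

Lemma fc_map_bind X Y Z (f : Y -> Z) w (u : X -> formal_comb R Y) :
  fc_map f (fc_bind w u) = fc_bind w (fc_map f \o u).
Proof.
rewrite fc_mapE fc_bindA; congr fc_bind.
by apply/funext => x; rewrite /= fc_mapE.
Qed.

Lemma fc_map_comp X Y Z (f : X -> Y) (g : Y -> Z) w :
  fc_map g (fc_map f w) = fc_map (g \o f) w :> formal_comb R Z.
Proof. by rewrite fc_mapE fc_bind_map -fc_mapE. Qed.

Lemma fc_map_id X (w : formal_comb R X) : fc_map id w = w.
Proof. by rewrite fc_mapE fc_bind_unitr. Qed.

Lemma fc_map_unit X Y (f : X -> Y) x : fc_map f (fc_unit R x) = fc_unit R (f x).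
Proof. by rewrite fc_mapE fc_bind_unit. Qed.

Lemma fc_map_mult X Y (f : X -> Y) (w : formal_comb R (formal_comb R X)) :
  fc_map f (fc_mult w) = fc_mult (fc_map (fc_map f) w).
Proof. by rewrite !fc_multE fc_map_bind fc_bind_map. Qed.

Definition fc_congr (I : set R) X (w w' : formal_comb R X) :=
  forall x, I (w x - w' x).

Lemma fc_congr_bindl (I : set R) X Y (w w' : formal_comb R X)
    (u : X -> formal_comb R Y) :
  open_right_ideal I -> fc_congr I w w' ->
  fc_congr I (fc_bind w u) (fc_bind w' u).
Proof.
move=> oI ww' y; rewrite !fc_bindE; apply: inf_sum_sub_ideal => //.
- by apply: cvg_zero_mulr; exact: coefP.
- by apply: cvg_zero_mulr; exact: coefP.
by move=> x; rewrite -mulrBl; case: oI => _ [_ _]; apply.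
Qed.

(** The differences are weighted on the left by [w x], so congruence of [u x] and [v x] modulo [I]
    would not be enough. *)
Lemma fc_congr_bindr (I : set R) X Y (w : formal_comb R X)
    (u v : X -> formal_comb R Y) :
  open_right_ideal I -> (forall x y, I (w x * (u x y - v x y))) ->
  fc_congr I (fc_bind w u) (fc_bind w v).
Proof.
move=> oI uv y; rewrite !fc_bindE; apply: inf_sum_sub_ideal => //.
- by apply: cvg_zero_mulr; exact: coefP.
- by apply: cvg_zero_mulr; exact: coefP.
by move=> x; rewrite -mulrBr.
Qed.

End Monad.

(** * Free contramodules, projectives and quotients *)

Section Contramodules.
Variable R : completeRightLinearRingType.
Implicit Types B C D : contramodule R.

Lemma contrahom_comp_subproof B C D (g : contrahom C D) (f : contrahom B C) r :
  (g \o f) (contraaction r) = contraaction (fc_map (g \o f) r).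
Proof. by rewrite /= !contrahomP fc_map_comp. Qed.

Definition contrahom_comp B C D (g : contrahom C D) (f : contrahom B C) :=
  Contrahom (contrahom_comp_subproof g f).

Lemma contrahom_id_subproof C (r : formal_comb R C) :
  id (contraaction r) = contraaction (fc_map id r).
Proof. by rewrite fc_map_id. Qed.

Definition contrahom_id C := Contrahom (@contrahom_id_subproof C).

Lemma free_assoc X (w : formal_comb R (formal_comb R (formal_comb R X))) :
  fc_mult (fc_mult w) = fc_mult (fc_map (@fc_mult R X) w).
Proof.
rewrite !fc_multE fc_bindA fc_bind_map; congr fc_bind.
by apply/funext => u /=; rewrite fc_multE.
Qed.

Lemma free_unit X (w : formal_comb R X) : fc_mult (fc_unit R w) = w.
Proof. by rewrite fc_multE fc_bind_unit. Qed.

Definition free X := Contramodule (@free_assoc X) (@free_unit X).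

Lemma free_ext_subproof X C (u : X -> C) (w : formal_comb R (free X)) :
  contraaction (fc_map u (contraaction w)) =
  contraaction (fc_map (fun r => contraaction (fc_map u r)) w).
Proof. by rewrite /= fc_map_mult contra_assoc fc_map_comp. Qed.

Definition free_ext X C (u : X -> C) : contrahom (free X) C :=
  Contrahom (@free_ext_subproof X C u).

Lemma free_ext_unit X C (u : X -> C) x : free_ext u (fc_unit R x) = u x.
Proof. by rewrite /= fc_map_unit contra_unit. Qed.

Lemma free_extE X C (g : contrahom (free X) C) :
  g =1 free_ext (fun x => g (fc_unit R x)).
Proof.
move=> w; rewrite /= -{1}[w]fc_bind_unitr /fc_bind.
by rewrite [LHS](@contrahomP _ (free X)) fc_map_comp.
Qed.

Lemma free_hom_eq X C (g h : contrahom (free X) C) :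
  (forall x, g (fc_unit R x) = h (fc_unit R x)) -> g =1 h.
Proof.
move=> gh w; rewrite free_extE [RHS]free_extE /=.
by congr (contraaction (fc_map _ w)); apply/funext.
Qed.

(** A homomorphism of free contramodules is right multiplication by a matrix, which a right ideal
    tolerates. *)
Lemma fc_congr_hom (I : set R) X Y (g : contrahom (free X) (free Y)) w w' :
  open_right_ideal I -> fc_congr I w w' -> fc_congr I (g w) (g w').
Proof. by move=> oI ww'; rewrite !(free_extE g); exact: fc_congr_bindl. Qed.

Lemma surj_epi B C (e : contrahom B C) :
  (forall c, exists b, e b = c) -> contra_epi e.
Proof. by move=> es Z g h gh c; have [b <-] := es c; exact: gh. Qed.

Lemma projective_section C : contra_projective C ->
  exists s : contrahom C (free C), forall c, contraaction (s c) = c.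
Proof.
move=> Cproj; pose e := free_ext (@id C).
have [|s es] := Cproj _ _ e (contrahom_id C).
  by apply: surj_epi => c; exists (fc_unit R c); exact: free_ext_unit.
by exists s => c; have := es c; rewrite /= fc_map_id.
Qed.

Lemma retract_projective (P F : contramodule R) (p : contrahom P F) (s : contrahom F P) :
  contra_projective P -> p \o s =1 id -> contra_projective F.
Proof.
move=> Pproj ps B C e g ee.
have [h eh] := Pproj _ _ e (contrahom_comp g p) ee.
exists (contrahom_comp h s) => x.
exact: etrans (eh (s x)) (congr1 g (ps x)).
Qed.

(** The quotient lives on chosen representatives and acts by evaluating in [C]. The last hypothesis
    is applied with [u] the passage to representatives. *)
Lemma quotient_contramodule C (E : C -> C -> Prop) :
  (forall x, E x x) -> (forall x y, E x y -> E y x) ->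
  (forall x y z, E x y -> E y z -> E x z) ->
  (forall (r : formal_comb R C) (u : C -> C), (forall x, E (u x) x) ->
    E (contraaction (fc_map u r)) (contraaction r)) ->
  exists Z (c : contrahom C Z), forall x y, c x = c y <-> E x y.
Proof.
move=> Er Es Et Ec; pose rep (x : C) := @xget {classic C} x (E x).
have repE x : E x (rep x).
  by rewrite /rep; case: xgetP => // /(_ x); apply; exact: Er.
have rep_eq x y : E x y -> rep x = rep y.
  move=> xy; have Exy : E x = E y.
    apply/funext => z; apply/propext.
    by split; [exact: (Et _ _ _ (Es _ _ xy)) | exact: Et].
  (* The default values of [xget] differ for [x] and [y], but the class is nonempty, so they never
     occur. *)
  rewrite /rep -Exy /xget; case: pselect => // nE.
  by exfalso; apply: nE; exists x; apply/asboolP; exact: Er.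
pose T := {x : C | rep x = x}.
have svalI (a b : T) : sval a = sval b -> a = b.
  case: a b => [a ha] [b hb] /= ab; case: _ / ab hb => hb.
  by congr exist; exact: Prop_irrelevance.
pose c x : T := exist _ (rep x) (esym (rep_eq _ _ (repE x))).
have cP x y : c x = c y <-> E x y.
  split=> [/(congr1 sval) /= xy|xy]; last by apply: svalI; exact: (rep_eq _ _ xy).
  by apply: Et (repE x) _; rewrite xy; exact: Es.
have cK (a : T) : c (sval a) = a by apply: svalI; exact: svalP a.
pose act (r : formal_comb R T) : T := c (contraaction (fc_map sval r)).
have act_map X (u : X -> C) (r : formal_comb R X) :
    act (fc_map (c \o u) r) = c (contraaction (fc_map u r)).
  rewrite /act fc_map_comp -[fc_map (sval \o _) r](fc_map_comp u (sval \o c)).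
  by apply/cP; apply: Ec => x; exact: Es.
have act_assoc w : act (fc_mult w) = act (fc_map act w).
  by rewrite act_map /act fc_map_mult contra_assoc fc_map_comp.
have act_unit a : act (fc_unit R a) = a.
  by rewrite /act fc_map_unit contra_unit cK.
have c_hom r : c (contraaction r) = act (fc_map c r).
  by rewrite (act_map _ id) fc_map_id.
pose Z := Contramodule act_assoc act_unit.
by exists Z, (@Contrahom _ _ Z c c_hom).
Qed.

End Contramodules.

(** * Pushing generators along the diagram, and eventual congruence *)

Lemma directed_upper_bound d (X : porderType d) (Y : eqType) (s : seq Y)
    (F : Y -> X) :
  directed X -> exists z, forall y, y \in s -> (F y <= z)%O.
Proof.
move=> [[x0 _] ub]; elim: s => [|y s [z hz]]; first by exists x0.
have [z' [yz' zz']] := ub (F y) z; exists z' => t; rewrite inE.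
by move=> /orP[/eqP -> //|/hz]; move/le_trans; exact.
Qed.

Section DirectLimit.
Variables (R : completeRightLinearRingType) (d : Order.disp_t).
Variables (X : porderType d) (hX : directed X).
Variables (P : X -> contramodule R).
Variable f : forall y x : X, (x < y)%O -> contrahom (P x) (P y).
Hypothesis hf : commutative_diagram f.
Hypothesis hP : forall x : X, contra_projective (P x).

Let T := {x : X & P x}.
Local Notation gen x a := (fc_unit R (existT P x a)).

Definition summand_section z : contrahom (P z) (free R T) :=
  contrahom_comp (free_ext (fun a => gen z a : free R T))
                 (projT1 (cid (projective_section (@hP z)))).

(** The diagram has maps only for [x < z], so [x = z] is a separate case, with transport along the
    equality. *)
Definition push_gen z (t : T) : free R T :=
  match pselect (projT1 t < z)%O with
  | left lt => summand_section z (f lt (projT2 t))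
  | right _ =>
    match pselect (projT1 t = z) with
    | left e => summand_section z (eq_rect _ P (projT2 t) _ e)
    | right _ => fc_unit R t
    end
  end.

Definition push z : contrahom (free R T) (free R T) := free_ext (push_gen z).

Lemma push_lt x z (xz : (x < z)%O) a :
  push z (gen x a) = summand_section z (f xz a).
Proof.
rewrite free_ext_unit /push_gen; case: pselect => //= xz'.
by rewrite (Prop_irrelevance xz' xz).
Qed.

Lemma push_id z a : push z (gen z a) = summand_section z a.
Proof.
rewrite free_ext_unit /push_gen; case: pselect => [zz|_].
  by exfalso; move: zz; rewrite ltxx.
by case: pselect => // e; rewrite (Prop_irrelevance e erefl).
Qed.

(** [gen x] is only a map of sets; after [push z] the relations of [P x] hold. *)
Lemma push_hom x z : (x <= z)%O ->
  exists h : contrahom (P x) (free R T), forall a, push z (gen x a) = h a.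
Proof.
rewrite le_eqVlt => /orP[/eqP <-|xz].
  by exists (summand_section x) => a; exact: push_id.
by exists (contrahom_comp (summand_section z) (f xz)) => a; exact: push_lt.
Qed.

Lemma push_diagram x y z (xy : (x < y)%O) a : (y <= z)%O ->
  push z (gen y (f xy a)) = push z (gen x a).
Proof.
rewrite le_eqVlt => /orP[/eqP <-|yz]; first by rewrite push_id (push_lt xy).
rewrite (push_lt yz) (push_lt (lt_trans xy yz)); congr (summand_section z _).
exact: hf.
Qed.

(** [z0] may depend on [I]: directedness bounds the finitely many thresholds that matter modulo [I],
    not infinitely many at once. *)
Definition eventually_close (w w' : free R T) : Prop :=
  forall I, open_right_ideal I ->
    exists z0, forall z, (z0 <= z)%O -> fc_congr I (push z w) (push z w').

Lemma eventually_eq_close w w' :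
  (exists z0, forall z, (z0 <= z)%O -> push z w = push z w') ->
  eventually_close w w'.
Proof.
move=> [z0 h] I [_ [I0 _ _]]; exists z0 => z /h -> x.
by rewrite subrr.
Qed.

Lemma eventually_close_refl w : eventually_close w w.
Proof. by apply: eventually_eq_close; have [[z _] _] := hX; exists z. Qed.

Lemma eventually_close_sym w w' :
  eventually_close w w' -> eventually_close w' w.
Proof.
move=> h I oI; have [z0 hz] := h I oI; exists z0 => z /hz ww' x.
exact: right_idealBC.
Qed.

Lemma eventually_close_trans w1 w2 w3 :
  eventually_close w1 w2 -> eventually_close w2 w3 -> eventually_close w1 w3.
Proof.
move=> h12 h23 I oI; have [z1 h1] := h12 I oI; have [z2 h2] := h23 I oI.
have [z0 [z10 z20]] := hX.2 z1 z2; exists z0 => z z0z x.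
apply: (right_ideal_trans oI (h1 z _ x)); first exact: le_trans z10 z0z.
by apply: h2; exact: le_trans z20 z0z.
Qed.

Lemma eventually_close_contraaction (w : formal_comb R (free R T))
    (u : free R T -> free R T) :
  (forall v, eventually_close (u v) v) ->
  eventually_close (contraaction (fc_map u w)) (contraaction w).
Proof.
move=> uv I oI; have [I0 _ IM] : right_ideal I by case: oI.
(* For each [v], closeness is used modulo a [J] with [w v * J] inside [I]. *)
have /choice[F hF] : forall v : free R T, exists z0, forall z, (z0 <= z)%O ->
    forall x, I (w v * ((push z (u v) : formal_comb R T) x -
                        (push z v : formal_comb R T) x)).
  move=> v; have [J oJ JI] := mul_open_right_ideal (w v) oI.
  have [z0 hz] := uv v J oJ; exists z0 => z z0z x; apply: JI; exact: hz.
(* Only the thresholds of [v] in [A] need a common bound: elsewhere [w v] is in [I], whatever [z]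
   is. *)
have [A hA] := cvg_zero_fset (coefP w) oI.
have [z0 hz] := directed_upper_bound A F hX; exists z0 => z z0z.
have pushE (v : free R T -> free R T) :
    push z (contraaction (fc_map v w)) = fc_bind w (push z \o v).
  exact: (fc_bindA w v (push_gen z)).
have pushw := pushE id; rewrite fc_map_id in pushw.
rewrite (pushE u) pushw.
apply: fc_congr_bindr => // v x.
have [vA|vA] := boolP ((v : {classic free R T}) \in A).
  by apply: hF; exact: le_trans (hz _ vA) z0z.
by apply: IM; exact: hA.
Qed.

(** * The canonical map from the free contramodule to the direct limit *)

Variables (F : contramodule R) (i : forall x : X, contrahom (P x) F).
Hypothesis hF : is_colimit f i.

Definition colimit_map : contrahom (free R T) F :=
  free_ext (fun t : T => i (projT1 t) (projT2 t)).

Lemma colimit_map_gen x a : colimit_map (gen x a) = i x a.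
Proof. exact: (free_ext_unit (fun t : T => i (projT1 t) (projT2 t))). Qed.

Lemma colimit_map_epi : contra_epi colimit_map.
Proof.
move=> Z g h gh; have [coc univ] := hF.
have [_] := univ Z (fun x => contrahom_comp g (i x)) (fun x y xy a =>
  congr1 g (coc x y xy a)).
apply=> x a //=; have /= := gh (gen x a).
by rewrite -colimit_map_gen => ->.
Qed.

Lemma colimit_map_push z w : colimit_map (push z w) = colimit_map w.
Proof.
have [coc _] := hF.
(* The identity is checked on generators of the free contramodule on [P z], then evaluated at
   [s b]. *)
have sectionE b : colimit_map (summand_section z b) = i z b.
  rewrite /summand_section; case: cid => s /= sK.
  rewrite [LHS](@free_hom_eq _ _ _ (contrahom_comp colimit_map
    (free_ext (fun a => gen z a : free R T))) (contrahom_comp (i z) (free_ext id))).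
    by rewrite /= fc_map_id sK.
  move=> a; apply: etrans (congr1 colimit_map (free_ext_unit _ a)) _.
  apply: etrans (colimit_map_gen a) _.
  exact: esym (congr1 (i z) (free_ext_unit (C := P z) id a)).
rewrite -[LHS]/(contrahom_comp colimit_map (push z) w).
apply: free_hom_eq => -[x a]; rewrite colimit_map_gen.
apply: etrans (congr1 colimit_map (free_ext_unit _ _)) _; rewrite /push_gen.
case: pselect => [xz|_].
  exact: etrans (sectionE _) (coc _ _ xz a).
case: pselect => [e|_]; last exact: colimit_map_gen.
by apply: etrans (sectionE _) _; case: _ / e.
Qed.

(** The maps sending [a] to [c (gen x a)], with [c] the quotient by eventual congruence, form a
    cocone; hence [c] factors through [colimit_map]. *)
Lemma colimit_map_eq w w' :
  colimit_map w = colimit_map w' -> eventually_close w w'.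
Proof.
have [Z [c cP]] := quotient_contramodule eventually_close_refl
  eventually_close_sym eventually_close_trans eventually_close_contraaction.
have [coc univ] := hF.
(* Both sides have the same push for every [z] above [x], by [push_hom]. *)
have hom x (r : formal_comb R (P x)) : c (gen x (contraaction r)) =
    contraaction (fc_map (fun a => c (gen x a)) r).
  apply: etrans _ (congr1 (@contraaction R Z)
    (fc_map_comp (fun a => gen x a : free R T) c r)).
  rewrite -contrahomP; apply/cP.
  apply: eventually_eq_close; exists x => z xz; have [h hE] := push_hom xz.
  rewrite hE (contrahomP h) (contrahomP (push z)) fc_map_comp.
  congr (contraaction (fc_map _ r)); apply/funext => a /=; by rewrite -hE.
have [|[h hc] _] := univ Z (fun x => Contrahom (@hom x)).
  move=> x y xy a /=; apply/cP; apply: eventually_eq_close; exists y => z.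
  exact: push_diagram.
have hqc : contrahom_comp h colimit_map =1 c.
  apply: free_hom_eq => -[x a].
  exact: etrans (congr1 h (colimit_map_gen a)) (hc x a).
move=> ww'; apply/cP.
exact: etrans (esym (hqc w)) (etrans (congr1 h ww') (hqc w')).
Qed.

(** * Projective covers of the direct limit *)

Lemma projective_cover_inj Q (p : contrahom Q F) :
  projective_cover p -> forall y y', p y = p y' -> y = y'.
Proof.
move=> [[Qproj lift] auto] y y' pyy'.
have ex_j x : {j : contrahom (P x) Q | p \o j =1 i x} by apply: cid; exact: lift.
pose j x := sval (ex_j x); have jP x : p \o j x =1 i x := svalP (ex_j x).
pose j' (t : T) : Q := j (projT1 t) (projT2 t).
pose v : contrahom (free R T) Q := free_ext j'.
have pv : contrahom_comp p v =1 colimit_map.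
  apply: free_hom_eq => -[x a]; rewrite colimit_map_gen.
  apply: etrans (congr1 p (free_ext_unit j' _)) _.
  exact: (jP x a).
have [u qu] := Qproj _ _ colimit_map p colimit_map_epi.
have [s sK] := projective_section Qproj.
(* [s] embeds [Q] in a free contramodule, where equality can be tested on each coefficient modulo
   each [I]. *)
suff sy : s y = s y' by rewrite -(sK y) sy sK.
apply: formal_combP => t; apply: eq_from_ideals => I oI.
have uu' : colimit_map (u y) = colimit_map (u y').
  exact: etrans (qu y) (etrans pyy' (esym (qu y'))).
have [z0 /(_ z0 (lexx _)) hz] := colimit_map_eq uu' oI.
(* This endomorphism commutes with [p] because [colimit_map] absorbs [push z0]. *)
have [|k kf _] := auto (contrahom_comp v (contrahom_comp (push z0) u)).
  move=> b; apply: etrans (pv _) _.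
  exact: etrans (colimit_map_push z0 (u b)) (qu b).
have skf b : s (k (v (push z0 (u b)))) = s b := congr1 s (kf b).
(* The inverse [k] depends on [I] through [z0]; this is harmless, as every homomorphism of free
   contramodules preserves congruence modulo [I]. *)
rewrite -(skf y) -(skf y').
exact: (fc_congr_hom (contrahom_comp s (contrahom_comp k v)) oI hz t).
Qed.

Lemma colimit_projective : has_projective_cover F -> contra_projective F.
Proof.
move=> [Q [p pcov]]; have pinj := projective_cover_inj pcov.
have [[Qproj lift] _] := pcov; have [coc univ] := hF.
have ex_j x : {j : contrahom (P x) Q | p \o j =1 i x} by apply: cid; exact: lift.
pose j x := sval (ex_j x); have jP x : p \o j x =1 i x := svalP (ex_j x).
(* The lifts [j x] are chosen independently; injectivity of [p] makes them a cocone. *)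
have [|[s si] _] := univ Q j.
  move=> x y xy a; apply: pinj.
  exact: etrans (jP y _) (etrans (coc x y xy a) (esym (jP x a))).
apply: (retract_projective (p := p) (s := s)) => // b.
(* [p \o s] and the identity are both induced by the cocone [i], so [F] is a retract of [Q]. *)
have [_ uniq] := univ F i coc.
apply: (uniq (contrahom_comp p s) (contrahom_id F)) => // x a.
exact: etrans (congr1 p (si x a)) (jP x a).
Qed.

End DirectLimit.

Theorem corollary7p5 (R : completeRightLinearRingType)
    (d : Order.disp_t) (X : porderType d) (hX : directed X)
    (P : X -> contramodule R)
    (f : forall y x : X, (x < y)%O -> contrahom (P x) (P y))
    (hf : commutative_diagram f)
    (hP : forall x : X, contra_projective (P x))
    (F : contramodule R) (i : forall x : X, contrahom (P x) F)
    (hF : is_colimit f i)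
    (hcov : has_projective_cover F) :
  contra_projective F.
Proof. exact: (colimit_projective hX hf hP hF hcov). Qed.
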